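(* Let $G$ be a graph of order $n$ with $C_2(G)=n$. Then every vertex $v$ of $G$ satisfies $\deg(v)\ge n-2$.
   Context: All graphs are finite, simple and undirected. A set $S\subseteq V(G)$ is a $2$-dominating set of $G$ if every vertex of $V(G)\setminus S$ has at least $2$ neighbours in $S$. Two sets $U_1,U_2\subseteq V(G)$ form a $2$-coalition if neither $U_1$ nor $U_2$ is a $2$-dominating set of $G$, but $U_1\cup U_2$ is. A $2$-coalition partition of $G$ is a partition $\Theta$ of $V(G)$ into nonempty sets such that every set of $\Theta$ either is a $2$-dominating set of $G$ with exactly $2$ elements, or forms a $2$-coalition with some other set of $\Theta$. The $2$-coalition number $C_2(G)$ is the maximum number of sets in a $2$-coalition partition of $G$. *)

(* Defs.v *)
From mathcomp Require Import all_boot.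

Set Implicit Arguments.
Unset Strict Implicit.
Unset Printing Implicit Defensive.

(* A finite simple graph is a symmetric irreflexive relation [e] on a finType;
   symmetry and irreflexivity are hypotheses of the statements, not of these
   definitions. *)

Definition neighbours (T : finType) (e : rel T) (v : T) : {set T} :=
  [set u | e v u].

Definition degree (T : finType) (e : rel T) (v : T) : nat :=
  #|neighbours e v|.

Definition two_dominating (T : finType) (e : rel T) (S : {set T}) : bool :=
  [forall v in ~: S, 2 <= #|neighbours e v :&: S|].

Definition two_coalition (T : finType) (e : rel T) (U1 U2 : {set T}) : bool :=
  [&& ~~ two_dominating e U1, ~~ two_dominating e U2
    & two_dominating e (U1 :|: U2)].

(* [partition] already requires the blocks to be nonempty. *)
Definition two_coalition_partition (T : finType) (e : rel T)
    (Theta : {set {set T}}) : bool :=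
  partition Theta [set: T] &&
  [forall U in Theta,
     (two_dominating e U && (#|U| == 2)) ||
     [exists W in Theta, (W != U) && two_coalition e U W]].

(* This is 0 when the graph has no 2-coalition partition. *)
Definition two_coalition_number (T : finType) (e : rel T) : nat :=
  \max_(Theta : {set {set T}} | two_coalition_partition e Theta) #|Theta|.

(* Main.v *)
(* A 2-coalition partition into n blocks consists of singletons, so every v has
   a partner w such that {v, w} is 2-dominating; each of the other n - 2
   vertices is then adjacent to both v and w. *)
Require Import Defs.
From mathcomp Require Import all_boot.

Set Implicit Arguments.
Unset Strict Implicit.
Unset Printing Implicit Defensive.

(** Blocks are nonempty, so each adds at least 1 to the sum of block sizes, which is [#|D|]; as this
    equals the number of blocks, every term is exactly 1. *)
Lemma partition_card_max (T : finType) (P : {set {set T}}) (D U : {set T}) :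
  partition P D -> #|P| = #|D| -> U \in P -> #|U| = 1.
Proof.
move=> partP cardP UP.
have [_ _ P0] := and3P partP.
have block_gt0 A : A \in P -> 1 <= #|A| ?= iff (1 == #|A|).
  by move=> AP; split=> //; rewrite card_gt0; apply: contraNneq P0 => <-.
have [_] := leqif_sum block_gt0.
rewrite sum1_card -(card_partition partP) cardP eqxx => /esym/forall_inP all1.
by apply/esym/eqP/all1.
Qed.

(** An empty [\max] is 0, so a positive value means that the maximum runs over a nonempty family and
    is attained. *)
Lemma two_coalition_number_attained (T : finType) (e : rel T) :
  0 < two_coalition_number e ->
  exists2 Theta : {set {set T}},
    two_coalition_partition e Theta & #|Theta| = two_coalition_number e.
Proof.
rewrite /two_coalition_number => max_gt0.
have [|Theta] :=
    @eq_bigmax_cond _ [pred P | two_coalition_partition e P]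
      (fun P : {set {set T}} => #|P|); last by exists Theta.
rewrite lt0n; apply: contraTneq max_gt0 => no_part.
by rewrite big_pred0 //; apply: card0_eq no_part.
Qed.

(** Without an edge to [v], the neighbours of [u] in the pair all lie in [[set w]], so there is at
    most one. *)
Lemma two_dominating_pair_adj (T : finType) (e : rel T) (v w u : T) :
  two_dominating e [set v; w] -> u \notin [set v; w] -> e u v.
Proof.
move=> /forall_inP dom; rewrite -in_setC => /dom; apply: contraLR => not_uv.
rewrite -ltnNge ltnS -(cards1 w) subset_leq_card //.
apply/subsetP=> x; rewrite !inE => /andP[ux /orP[/eqP xv|//]].
by rewrite -xv ux in not_uv.
Qed.

Lemma degree_two_dominating_pair (T : finType) (e : rel T) (v w : T) :
  symmetric e -> two_dominating e [set v; w] -> #|T| - 2 <= degree e v.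
Proof.
move=> e_sym dom.
apply: (@leq_trans #|~: [set v; w]|).
  (* The pair has at most 2 elements; [v = w] is allowed here. *)
  by rewrite cardsCs setCK leq_sub2l // cards2; case: eqP.
apply/subset_leq_card/subsetP=> u; rewrite in_setC => u_out.
by rewrite inE e_sym (two_dominating_pair_adj dom u_out).
Qed.

Theorem theorem11 (T : finType) (e : rel T) (n : nat)
  (e_sym : symmetric e) (e_irr : irreflexive e)
  (order_n : #|T| = n) (C2_n : two_coalition_number e = n) (v : T) :
  degree e v >= n - 2.
Proof.
have [|Theta /andP[part /forall_inP coal]] :=
    @two_coalition_number_attained _ e.
  by rewrite C2_n -order_n; apply/card_gt0P; exists v.
rewrite C2_n -order_n -cardsT => cardTheta.
have single := partition_card_max part cardTheta.
have v_cover : v \in cover Theta by rewrite (cover_partition part).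
have [/coal] := (pblock_mem v_cover, pblock_mem v_cover).
set U := pblock Theta v => + UTheta.
have vU : v \in U by rewrite mem_pblock.
have /eqP/cards1P[x defU] := single U UTheta.
(* A block of size 1 cannot be a 2-dominating set of size 2, so it has a coalition partner [W]. *)
rewrite single // andbF /= => /exists_inP[W WTheta /andP[_ /and3P[_ _]]].
have /eqP/cards1P[w ->] := single W WTheta.
move: vU; rewrite defU inE => /eqP <- dom.
by rewrite cardsT (degree_two_dominating_pair e_sym dom).
Qed.
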